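(* For every integer $n\ge 1$, the function $r\mapsto P_n(r)$ is decreasing on $(-\infty,1]$. Moreover, for every integer $n\geq 1$ and all real numbers $r,r'$ with $r\le 1$ and $r'>r$, one has $P_n(r)\ge P_n(r')$.
   Context: For an integer $n\ge1$ and a real number $r\neq 0$, $$P_n(r)=\left(\frac{\frac1n\sum_{i=1}^n i^r}{\frac1{n+1}\sum_{i=1}^{n+1} i^r}\right)^{1/r},\qquad\text{and}\qquad P_n(0)=\frac{\sqrt[n]{n!}}{\sqrt[n+1]{(n+1)!}}.$$ ''Decreasing'' is meant in the non-strict sense (non-increasing). *)

(* Defs.v *)
From mathcomp Require Import all_boot all_order all_algebra.
From mathcomp Require Import all_classical all_reals all_analysis.
Set Implicit Arguments.
Unset Strict Implicit.
Unset Printing Implicit Defensive.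
Import Order.TTheory GRing.Theory Num.Theory.
Local Open Scope ring_scope.

Section PowerMeanRatio.
Variable R : realType.
Implicit Types (n : nat) (r : R).

Definition power_avg n r : R := n%:R^-1 * \sum_(1 <= i < n.+1) (i%:R `^ r).

(* All bases are positive, where powR is the usual real power; the n-th root of n!
   is its power 1/n. *)
Definition mean_ratio n r : R :=
  if r == 0 then (n`!%:R `^ n%:R^-1) / ((n.+1)`!%:R `^ n.+1%:R^-1)
  else (power_avg n r / power_avg n.+1 r) `^ r^-1.

End PowerMeanRatio.

(* Main.v *)
Require Import Defs.
From mathcomp Require Import all_boot all_order all_algebra.
From mathcomp Require Import all_classical all_reals all_analysis.
From mathcomp Require Import ring lra.
Import Order.TTheory GRing.Theory Num.Theory.
Local Open Scope ring_scope.

(** Write E_q(v) = (v^q - 1)/q for q <> 0 and E_0 = ln (the Box-Cox transform),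
    so that orders of every sign, and order 0, can be treated at once.  For
    c > 0 put
      gap_q(c) = n * sum_(i <= n+1) E_q(c i) - (n+1) * sum_(i <= n) E_q(i).
    Since E_q is strictly increasing, so is gap_q, and its zero is exactly
    c = P_n(q).  Hence P_n(q) <= P_n(r) amounts to gap_q(P_n(r)) >= 0.

    Distribute the n copies of each i <= n+1 so that block k <= n receives n+1-k
    copies of k and k copies of k+1.  As E_q(k v) - E_q(k) = k^q E_q(v), this gives
      gap_q(c) = sum_(k <= n) k^q ((n+1-k) E_q(c) + k E_q(c (1 + 1/k))).
    Two facts about E finish the proof, for c = P_n(r), r <= 1 and q >= r.
    - E_q(v) is nondecreasing in q ([le_box_cox]), so each bracket is at least
      the same bracket W_k with r in place of q.
    - E_r is concave for r <= 1 and E_r(1) = 0, so k E_r(1 + 1/k), hence also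
      W_k = (n+1) E_r(c) + c^r k E_r(1 + 1/k), is nondecreasing in k
      ([box_cox_step_mono]).
    Now sum k^r W_k = gap_r(P_n(r)) = 0, while k^(q-r) is nondecreasing, and so
    Chebyshev's sum inequality ([chebyshev_sum_ge0]) gives
    gap_q(c) >= sum k^(q-r) k^r W_k >= 0. *)

(** * The Box-Cox transform *)

Section BoxCox.
Variable R : realType.
Implicit Types (q r u v w x y t : R) (k : nat).

Definition box_cox q v : R := if q == 0 then ln v else (v `^ q - 1) / q.

Lemma box_cox1 q : box_cox q 1 = 0.
Proof. by rewrite /box_cox; case: ifP; rewrite ?ln1// powR1 subrr mul0r. Qed.

Lemma box_cox_exp1 v : 0 < v -> box_cox 1 v = v - 1.
Proof. by move=> v0; rewrite /box_cox oner_eq0 powRr1 ?ltW// divr1. Qed.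

Lemma box_coxM q u v : 0 < u -> 0 < v ->
  box_cox q (u * v) = box_cox q u + u `^ q * box_cox q v.
Proof.
move=> u0 v0; rewrite /box_cox; have [->|q0] := eqVneq q 0.
  by rewrite lnM ?posrE// powRr0 mul1r.
by rewrite powRM ?ltW//; field.
Qed.

Lemma box_cox_gt0 q v : 1 < v -> 0 < box_cox q v.
Proof.
move=> v1; have v0 : 0 < v by exact: lt_trans v1.
rewrite /box_cox; have [q0|q0|_] := ltgtP q 0; last exact: ln_gt0.
- rewrite ltr_ndivlMr// mul0r subr_lt0 /powR gt_eqF//.
  by rewrite expR_lt1 nmulr_rlt0// ln_gt0.
- rewrite divr_gt0// subr_gt0 /powR gt_eqF//.
  by rewrite expR_gt1 mulr_gt0// ln_gt0.
Qed.

Lemma box_cox_lt q v w : 0 < v -> v < w -> box_cox q v < box_cox q w.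
Proof.
move=> v0 vw; have w0 : 0 < w by exact: lt_trans vw.
have -> : w = v * (w / v) by rewrite mulrC divfK ?gt_eqF.
rewrite box_coxM ?divr_gt0// ltrDl mulr_gt0 ?powR_gt0// box_cox_gt0//.
by rewrite ltr_pdivlMr// mul1r.
Qed.

(** The tangent line of the exponential at [x], in multiplicative form. *)
Lemma expR_tangent x y : expR x * (1 + (y - x)) <= expR y.
Proof.
have {2}-> : y = x + (y - x) by ring.
by rewrite expRD ler_pM2l ?expR_gt0// expR_ge1Dx.
Qed.

(** With t = ln v, comparison with order 0 is 1 + p t <= e^(p t).  For r and q
    of the same sign, e^(r t) (if positive) or e^(q t) (if negative) lies between
    1 and the other exponential, and convexity follows by adding the two tangent
    inequalities at that intermediate point with the appropriate weights. *)
Lemma le_box_cox r q v : 0 < v -> r <= q -> box_cox r v <= box_cox q v.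
Proof.
move=> v0; rewrite le_eqVlt => /predU1P[->//|rq].
have powE p : v `^ p = expR (p * ln v) by rewrite /powR gt_eqF.
rewrite /box_cox !powE; set t := ln v.
have neg p : p < 0 -> (expR (p * t) - 1) / p <= t.
  move=> p0; rewrite ler_ndivrMr//.
  by have := expR_ge1Dx (p * t); lra.
have pos p : 0 < p -> t <= (expR (p * t) - 1) / p.
  move=> p0; rewrite ler_pdivlMr//.
  by have := expR_ge1Dx (p * t); lra.
have [r0|r0|r0] := ltgtP r 0; have [q0|q0|q0] := ltgtP q 0; try lra.
- have H1 := expR_tangent (q * t) (r * t).
  have H2 := expR_tangent (q * t) 0.
  rewrite expR0 in H2.
  rewrite -subr_ge0.
  set a := expR (q * t) in H1 H2 *; set b := expR (r * t) in H1 *.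
  have -> : (a - 1) / q - (b - 1) / r
    = (r * a - q * b + (q - r)) / (q * r) by field; rewrite !lt_eqF.
  apply: divr_ge0; last by rewrite mulr_le0// ltW.
  have q0' : 0 <= - q by lra.
  have qr0 : 0 <= q - r by lra.
  by have := ler_wpM2l q0' H1; have := ler_wpM2l qr0 H2; lra.
- exact: le_trans (neg _ r0) (pos _ q0).
- exact: neg.
- have H1 := expR_tangent (r * t) (q * t).
  have H2 := expR_tangent (r * t) 0.
  rewrite expR0 in H2.
  rewrite -subr_ge0.
  set a := expR (q * t) in H1 *; set b := expR (r * t) in H1 H2 *.
  have -> : (a - 1) / q - (b - 1) / r
    = (r * a - q * b + (q - r)) / (q * r) by field; rewrite !gt_eqF.
  apply: divr_ge0; last by rewrite mulr_ge0// ltW.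
  have qr0 : 0 <= q - r by lra.
  by have := ler_wpM2l (ltW r0) H1; have := ler_wpM2l qr0 H2; lra.
- exact: pos.
Qed.

(** The tangent line of E_r at [w]: by [box_coxM] it is the tangent line at 1
    rescaled, and the latter is the comparison of E_r with E_1(v) = v - 1. *)
Lemma box_cox_tangent r v w : r <= 1 -> 0 < v -> 0 < w ->
  box_cox r v <= box_cox r w + w `^ r * (v / w - 1).
Proof.
move=> r1 v0 w0; have vw0 : 0 < v / w by rewrite divr_gt0.
have {1}-> : v = w * (v / w) by rewrite mulrC divfK ?gt_eqF.
rewrite box_coxM// lerD2l ler_pM2l ?powR_gt0// -box_cox_exp1//.
exact: le_box_cox.
Qed.

(** Concavity along the segment from 1, where E_r vanishes, to [v]: the tangent
    line at the intermediate point lies above E_r at both ends. *)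
Lemma box_cox_concave1 r v t : r <= 1 -> 0 < v -> 0 < t <= 1 ->
  t * box_cox r v <= box_cox r (1 + t * (v - 1)).
Proof.
move=> r1 v0 /andP[t0 t1]; set w := 1 + _.
have w0 : 0 < w by rewrite /w; nra.
have Hv := box_cox_tangent r v w r1 v0 w0.
have H1 := box_cox_tangent r 1 w r1 ltr01 w0.
rewrite box_cox1 in H1.
set b := box_cox r w in Hv H1 *; set p := w `^ r in Hv H1.
have e : t * (p * (v / w - 1)) + (1 - t) * (p * (1 / w - 1)) = 0.
  by rewrite /w; field; rewrite -/w gt_eqF.
nra.
Qed.

(** The slope of E_r between 1 and 1 + x is nonincreasing in x by concavity;
    take x = 1/k. *)
Lemma box_cox_step_mono r k : r <= 1 -> (0 < k)%N ->
  k%:R * box_cox r (1 + k%:R^-1) <= k.+1%:R * box_cox r (1 + k.+1%:R^-1).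
Proof.
move=> r1 k0; have kR : 0 < k%:R :> R by rewrite ltr0n.
have k1R : 0 < k.+1%:R :> R by rewrite ltr0n.
have v0 : 0 < 1 + k%:R^-1 :> R by rewrite addr_gt0// invr_gt0.
have t01 : 0 < (k%:R / k.+1%:R : R) <= 1.
  by rewrite divr_gt0//= ler_pdivrMr// mul1r ler_nat.
have := box_cox_concave1 r (1 + k%:R^-1) (k%:R / k.+1%:R) r1 v0 t01.
have -> : 1 + k%:R / k.+1%:R * (1 + k%:R^-1 - 1) = 1 + k.+1%:R^-1 :> R.
  by field; rewrite !gt_eqF.
by rewrite mulrAC ler_pdivrMr// [X in _ <= X]mulrC.
Qed.

End BoxCox.
Arguments box_cox {R} q v.

(** * Two facts about finite sums *)

Section Sums.
Variable R : realType.

(** Each term of the double sum of w_i w_j (g_i - g_j) (W_i - W_j) is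
    nonnegative, and since the [w]-mean of [W] vanishes the double sum collapses
    to twice the total weight times the sum to be bounded. *)
Lemma chebyshev_sum_ge0 (s : seq nat) (w g W : nat -> R) :
    {in s, forall k, 0 <= w k} -> 0 < \sum_(k <- s) w k ->
    {in s &, forall j k, (j <= k)%N -> g j <= g k} ->
    {in s &, forall j k, (j <= k)%N -> W j <= W k} ->
    \sum_(k <- s) w k * W k = 0 ->
  0 <= \sum_(k <- s) g k * (w k * W k).
Proof.
move=> w0 w_gt0 gm Wm W0.
have : 0 <= \sum_(i <- s) \sum_(j <- s)
    w i * w j * ((g i - g j) * (W i - W j)).
  rewrite big_seq; apply: sumr_ge0 => i si; rewrite big_seq.
  apply: sumr_ge0 => j sj; apply: mulr_ge0; first by rewrite mulr_ge0 ?w0.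
  have [ij|/ltnW ji] := leqP i j.
    by rewrite mulr_le0// subr_le0 ?gm ?Wm.
  by rewrite mulr_ge0// subr_ge0 ?gm ?Wm.
set S := \sum_(k <- s) g k * _; set T := \sum_(k <- s) w k in w_gt0 *.
have -> : \sum_(i <- s) \sum_(j <- s) w i * w j * ((g i - g j) * (W i - W j))
    = 2 * (T * S).
  transitivity (\sum_(i <- s) (g i * (w i * W i) * T + w i * S
                               - w i * W i * \sum_(j <- s) w j * g j)).
    apply: eq_bigr => i _.
    (* The subtracted last term vanishes; it makes the identity hold termwise. *)
    rewrite [RHS](_ : _ = g i * (w i * W i) * T + w i * S
      - w i * W i * (\sum_(j <- s) w j * g j)
      - w i * g i * (\sum_(k <- s) w k * W k)); last by rewrite W0; ring.
    rewrite !mulr_sumr -big_split/= -!sumrB.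
    by apply: eq_bigr => j _; ring.
  by rewrite sumrB big_split/= -!mulr_suml W0 -/T -/S; ring.
by rewrite pmulr_rge0// pmulr_rge0.
Qed.

(** With N = m + 1 this redistributes m copies of each of G 1, ..., G (m + 1) into
    m blocks of size m + 1, block k mixing only G k and G (k + 1). *)
Lemma sum_interleave (G : nat -> R) (N : R) m :
  \sum_(1 <= k < m.+1) ((N - k%:R) * G k + k%:R * G k.+1)
  = (N - 1) * (\sum_(1 <= i < m.+1) G i) + m%:R * G m.+1.
Proof.
elim: m => [|m IH]; first by rewrite !big_nil mulr0 mul0r addr0.
by rewrite big_nat_recr//= [in RHS]big_nat_recr//= IH -natr1; ring.
Qed.

End Sums.

(** * Ratios of consecutive power means *)

Section MeanRatio.
Variable R : realType.
Implicit Types (q r c : R) (n k : nat).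

(** Up to the factor n (n+1), the difference between the averages of E_q over
    c, 2c, ..., (n+1)c and over 1, ..., n. *)
Definition power_gap n q c : R :=
  n%:R * (\sum_(1 <= i < n.+2) box_cox q (c * i%:R))
  - n.+1%:R * \sum_(1 <= i < n.+1) box_cox q i%:R.

(** The bracket W_k above, arranged so that only a multiple of the monotone
    quantity of [box_cox_step_mono] depends on [k]. *)
Definition gap_weight n q c k : R :=
  n.+1%:R * box_cox q c
  + c `^ q * (k%:R * box_cox q (1 + k%:R^-1)).

(** Regrouping by blocks with [sum_interleave]; the n+1 copies of E_q(k) then
    cancel against block k, because E_q(k v) = E_q(k) + k^q E_q(v). *)
Lemma power_gapE n q c : 0 < c ->
  power_gap n q c = \sum_(1 <= k < n.+1) k%:R `^ q *
    ((n.+1%:R - k%:R) * box_cox q c + k%:R * box_cox q (c * (1 + k%:R^-1))).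
Proof.
move=> c0; rewrite /power_gap.
have -> : n%:R * (\sum_(1 <= i < n.+2) box_cox q (c * i%:R)) =
   \sum_(1 <= k < n.+1) ((n.+1%:R - k%:R) * box_cox q (c * k%:R)
      + k%:R * box_cox q (c * k.+1%:R)).
  by rewrite sum_interleave big_nat_recr//= -natr1; ring.
rewrite mulr_sumr -sumrB; apply: eq_big_nat => k /andP[k0 _].
have kR : 0 < k%:R :> R by rewrite ltr0n.
have -> : c * k.+1%:R = k%:R * (c * (1 + k%:R^-1)).
  by rewrite -natr1; field; rewrite gt_eqF.
rewrite [c * k%:R]mulrC !box_coxM ?mulr_gt0 ?addr_gt0 ?invr_gt0//.
by ring.
Qed.

Lemma power_gap_weightE n q c : 0 < c ->
  power_gap n q c = \sum_(1 <= k < n.+1) k%:R `^ q * gap_weight n q c k.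
Proof.
move=> c0; rewrite power_gapE//; apply: eq_big_nat => k /andP[k0 _].
rewrite box_coxM ?addr_gt0 ?invr_gt0 ?ltr0n// /gap_weight; ring.
Qed.

Lemma gap_weight_mono n r c j k : r <= 1 -> (0 < j)%N -> (j <= k)%N ->
  gap_weight n r c j <= gap_weight n r c k.
Proof.
move=> r1 j0 /subnK <-; elim: (k - j)%N => [|d IH]//.
apply: le_trans IH _; rewrite addSn lerD2l ler_wpM2l ?powR_ge0//.
by apply: box_cox_step_mono; rewrite // addn_gt0 j0 orbT.
Qed.

Lemma power_gap_lt n q c c' : (0 < n)%N -> 0 < c -> c < c' ->
  power_gap n q c < power_gap n q c'.
Proof.
move=> n0 c0 cc'; rewrite ltrD2r ltr_pM2l ?ltr0n//.
apply: ltr_sum_nat => // i /andP[i0 _].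
have iR : 0 < i%:R :> R by rewrite ltr0n.
by apply: box_cox_lt; rewrite ?mulr_gt0// ltr_pM2r.
Qed.

(** The zero of the gap of order [r] makes every gap of larger order
    nonnegative: termwise comparison of E_q with E_r, then Chebyshev. *)
Lemma power_gap_ge0_le n r q c : (0 < n)%N -> r <= 1 -> r <= q -> 0 < c ->
  power_gap n r c = 0 -> 0 <= power_gap n q c.
Proof.
move=> n0 r1 rq c0 rc0.
apply: (@le_trans _ _ (\sum_(1 <= k < n.+1) k%:R `^ (q - r) *
    (k%:R `^ r * gap_weight n r c k))).
  apply: chebyshev_sum_ge0.
  - by move=> k _; exact: powR_ge0.
  - rewrite big_nat_recl// ltr_pwDl ?powR_gt0 ?ltr0n// .
    by apply: sumr_ge0 => k _; exact: powR_ge0.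
  - move=> j k _ _ jk.
    by apply: ge0_ler_powR; rewrite ?nnegrE ?subr_ge0 ?ler_nat.
  - move=> j k; rewrite mem_index_iota => /andP[j0 _] _ jk.
    exact: gap_weight_mono.
  - by rewrite -power_gap_weightE.
rewrite power_gapE//; apply: ler_sum_nat => k /andP[k0 kn].
have kR : 0 < k%:R :> R by rewrite ltr0n.
rewrite mulrA -powRD ?(gt_eqF kR) ?implybT// subrK ler_pM2l ?powR_gt0//.
have -> : gap_weight n r c k = (n.+1%:R - k%:R) * box_cox r c
    + k%:R * box_cox r (c * (1 + k%:R^-1)).
  by rewrite box_coxM ?addr_gt0 ?invr_gt0// /gap_weight; ring.
apply: lerD; apply: ler_wpM2l.
- by rewrite subr_ge0 ler_nat ltnW.
- exact: le_box_cox.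
- exact: ltW.
- by apply: le_box_cox; rewrite // mulr_gt0// addr_gt0// invr_gt0.
Qed.

Lemma power_avg_gt0 n q : (0 < n)%N -> 0 < power_avg n q.
Proof.
move=> n0; rewrite mulr_gt0 ?invr_gt0 ?ltr0n//.
rewrite big_nat_recl// ltr_pwDl ?powR_gt0 ?ltr0n//.
by apply: sumr_ge0 => k _; exact: powR_ge0.
Qed.

Lemma mean_ratio_gt0 n q : (0 < n)%N -> 0 < mean_ratio n q.
Proof.
move=> n0; rewrite /mean_ratio; case: ifP => _.
  by rewrite divr_gt0// powR_gt0// ltr0n fact_gt0.
by rewrite powR_gt0// divr_gt0 ?power_avg_gt0.
Qed.

Lemma sum_ln_nat n : \sum_(1 <= i < n.+1) ln i%:R = ln (n`!%:R) :> R.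
Proof.
elim: n => [|n IH]; first by rewrite big_nil fact0 ln1.
by rewrite big_nat_recr//= IH factS natrM mulrC lnM ?posrE ?ltr0n ?fact_gt0.
Qed.

(** For q <> 0 the gap is n (n+1) (c^q A_(n+1) - A_n) / q, where A_m is the
    average of the q-th powers up to m, and for q = 0 it is n (n+1) times
    ln c + ln (n+1)!/(n+1) - ln n!/n; so [mean_ratio] is by definition its zero. *)
Lemma power_gap_mean_ratio n q : (0 < n)%N ->
  power_gap n q (mean_ratio n q) = 0.
Proof.
move=> n0; have c0 := mean_ratio_gt0 n q n0.
have nR : 0 < n%:R :> R by rewrite ltr0n.
have mR : 0 < n.+1%:R :> R by rewrite ltr0n.
have factR m : 0 < m`!%:R :> R by rewrite ltr0n fact_gt0.
set c := mean_ratio n q in c0 *.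
have -> : power_gap n q c = n%:R * (n.+1%:R * box_cox q c +
    c `^ q * \sum_(1 <= i < n.+2) box_cox q i%:R)
  - n.+1%:R * \sum_(1 <= i < n.+1) box_cox q i%:R.
  congr (_ * _ - _); rewrite mulr_sumr.
  under eq_big_nat => i /andP[i0 _] do rewrite box_coxM ?ltr0n//.
  by rewrite big_split/= sumr_const_nat subn1 mulr_natl.
rewrite /c /mean_ratio /box_cox; have [->|q0] := eqVneq q 0.
  rewrite !sum_ln_nat powRr0 lnM ?lnV ?posrE ?invr_gt0 ?powR_gt0//.
  by rewrite !ln_powR; field; rewrite -natr1 in mR; rewrite !gt_eqF.
have s m : \sum_(1 <= i < m.+1) ((i%:R `^ q - 1) / q)
    = (m%:R * power_avg m q - m%:R) / q :> R.
  have [->|m0] := posnP m; first by rewrite big_nil !mul0r subrr mul0r.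
  rewrite -mulr_suml sumrB sumr_const_nat subn1 /power_avg mulrA.
  by rewrite divff ?pnatr_eq0 -?lt0n// mul1r.
rewrite !s -powRrM mulVf// powRr1; last first.
  by rewrite divr_ge0// ltW// power_avg_gt0.
have := power_avg_gt0 n.+1 q isT; move: (power_avg n.+1 q) => A A0.
by field; rewrite q0 gt_eqF.
Qed.

Lemma mean_ratio_le n r q : (0 < n)%N -> r <= 1 -> r <= q ->
  mean_ratio n q <= mean_ratio n r.
Proof.
move=> n0 r1 rq; rewrite leNgt; apply/negP => lt_rq.
have rpos := mean_ratio_gt0 n r n0.
have := power_gap_ge0_le n r q _ n0 r1 rq rpos (power_gap_mean_ratio n r n0).
by rewrite leNgt -(power_gap_mean_ratio n q n0) power_gap_lt.
Qed.

End MeanRatio.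

Theorem corollary2p3 (R : realType) :
  (forall n : nat, (1 <= n)%N ->
     {in `]-oo, 1] &, nonincreasing_fun (@mean_ratio R n)}) /\
  (forall (n : nat) (r r' : R), (1 <= n)%N -> r <= 1 -> r < r' ->
     mean_ratio n r >= mean_ratio n r').
Proof.
split=> [n n0 r q|n r q n0 r1 /ltW rq]; last exact: mean_ratio_le.
by rewrite in_itv/= => r1 _ rq; exact: mean_ratio_le.
Qed.
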